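(* Let $A\subset\mathbb{R}^d$ be a finite set of sites in general position. The bifiltrations $\textnormal{S-Rhomb}=(\textnormal{S-Rhomb}_{r,k})$ and $\textnormal{S-Del}=(\textnormal{S-Del}_{r,k})$, indexed by $(r,k)\in[0,\infty)\times\mathbb{N}$, are weakly equivalent.
   Context: $\mathbb{N}=\{1,2,\dots\}$. Bifiltrations are indexed by $[0,\infty)\times\mathbb{N}$ with $(r,k)\le(r',k')$ iff $r\le r'$ and $k\ge k'$, and consist of spaces $X_{r,k}$ with $X_{r,k}\subseteq X_{r',k'}$ when $(r,k)\le(r',k')$. A morphism is a family of continuous maps commuting with the inclusions; it is an objectwise homotopy equivalence if each component is a homotopy equivalence; $X,Y$ are weakly equivalent if connected by a finite zigzag of objectwise homotopy equivalences. Each polyhedral or simplicial complex below is regarded as a space via its (geometric) realization. Simplicial side: for $\tilde A\subseteq A$ let $\mathrm{Ball}_r(\tilde A)=\{b: \|b-\tilde a\|\le r\ \forall\tilde a\in\tilde A\}$ and for $|\tilde A|=k$ let $\mathrm{Vor}(\tilde A)=\{b\in\mathbb{R}^d: \|b-\tilde a\|\le\|b-a\|\ \forall\tilde a\in\tilde A, a\in A\setminus\tilde A\}$. Let $\mathrm{Del}^{+}_{r,k}$ be the abstract simplicial complex whose vertices are subsets $\tilde A\subseteq A$ with $|\tilde A|\in\{k,k+1\}$ and whose simplices are the sets $\sigma$ of such subsets with $\bigcap_{\tilde A\in\sigma}(\mathrm{Ball}_r(\tilde A)\cap\mathrm{Vor}(\tilde A))\neq\emptyset$; $\textnormal{S-Del}_{r,k}=\bigcup_{i\ge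 k}\mathrm{Del}^{+}_{r,i}$. Rhomboid side: a $(d-1)$-sphere $S\subset\mathbb{R}^d$ partitions $A=A_{in}\sqcup A_{on}\sqcup A_{out}$. The combinatorial rhomboid of $S$ is $\rho_S=\{A_{in}\cup Q: Q\subseteq A_{on}\}$; a vertex $v=\{a_1,\dots,a_m\}$ is embedded as $(\sum_i a_i,-m)\in\mathbb{R}^{d+1}$ (depth $m$), and the geometric rhomboid is the convex hull of the embedded vertices. The rhomboid tiling is the polyhedral complex of all rhomboids $\rho_S$. For a rhomboid $\rho$, $r_\rho$ is the infimum of radii of spheres $S$ with $\rho_S=\rho$. The sliced rhomboid tiling is obtained by cutting every rhomboid along the hyperplanes $\{x_{d+1}=-j\}$, $j=0,\dots,|A|$; its cells (sliced rhomboids) are the intersections of rhomboids with these hyperplanes and with the slabs $\{j\le-x_{d+1}\le j+1\}$. For a sliced rhomboid $\rho$, $k_\rho$ is the minimum depth of its vertices and $r_\rho:=r_{\rho'}$ with $\rho'$ the smallest-dimensional rhomboid containing $\rho$. $\textnormal{S-Rhomb}_{r,k}$ is the polyhedral complex $\{\rho \text{ sliced rhomboid}: r_\rho\le r, k_\rho\ge k\}$. *)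

(* Defs.v *)
From HB Require Import structures.
From mathcomp Require Import all_boot all_order all_algebra.
From mathcomp Require Import all_classical all_reals all_analysis.
Set Implicit Arguments. Unset Strict Implicit. Unset Printing Implicit Defensive.
Import Order.TTheory GRing.Theory Num.Theory.
Import numFieldNormedType.Exports.
Local Open Scope classical_set_scope.
Local Open Scope ring_scope.

Section Geometry.
Variables (R : realType) (d : nat).

Definition edist (x y : 'rV[R]_d) : R :=
  Num.sqrt (\sum_(j < d) (x 0 j - y 0 j) ^+ 2).

Definition dotp (x y : 'rV[R]_d) : R := \sum_(j < d) x 0 j * y 0 j.
End Geometry.

Section Sites.
Variables (R : realType) (d n : nat) (a : 'I_n -> 'rV[R]_d).

Definition general_position : Prop :=
  injective a /\
  (forall S : {set 'I_n}, #|S| = d.+1 ->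
     ~ exists (u : 'rV[R]_d) (b : R), u != 0 /\ forall i, i \in S -> dotp (a i) u = b) /\
  (forall S : {set 'I_n}, #|S| = d.+2 ->
     ~ exists (c : 'rV[R]_d) (rho : R), forall i, i \in S -> edist (a i) c = rho).

Definition A_in (c : 'rV[R]_d) (rho : R) : {set 'I_n} := [set i | edist (a i) c < rho].
Definition A_on (c : 'rV[R]_d) (rho : R) : {set 'I_n} := [set i | edist (a i) c == rho].

Definition comb_rhomb (c : 'rV[R]_d) (rho : R) : {set {set 'I_n}} :=
  [set A_in c rho :|: Q | Q in powerset (A_on c rho)].

Definition is_rhomboid (F : {set {set 'I_n}}) : Prop :=
  exists c rho, 0 < rho /\ comb_rhomb c rho = F.

Definition rhomb_radius (F : {set {set 'I_n}}) : R :=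
  inf [set rho | exists c, 0 < rho /\ comb_rhomb c rho = F].

Definition emb (v : {set 'I_n}) : 'rV[R]_(d + 1) :=
  row_mx (\sum_(i in v) a i) (const_mx (- (#|v|%:R))).

Definition depth (x : 'rV[R]_(d + 1)) : R := - x 0 (rshift d ord0).

Definition hull (F : {set {set 'I_n}}) : set 'rV[R]_(d + 1) :=
  [set x | exists w : {set 'I_n} -> R,
     (forall v, 0 <= w v) /\ (forall v, v \notin F -> w v = 0) /\
     \sum_v w v = 1 /\ x = \sum_v w v *: emb v].

(* affine dimension of the convex hull of the embedded vertices of F *)
Definition adim (F : {set {set 'I_n}}) : nat :=
  (\rank (\matrix_(i < #|F|) row_mx (emb (enum_val i)) (1 : 'rV[R]_1))).-1.

Definition hyp_slice (j : nat) : set 'rV[R]_(d + 1) := [set x | depth x = j%:R].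
Definition slab_slice (j : nat) : set 'rV[R]_(d + 1) :=
  [set x | j%:R <= depth x <= j.+1%:R].

Definition is_sliced_rhomboid (C : set 'rV[R]_(d + 1)) : Prop :=
  exists F j, is_rhomboid F /\ (j <= n)%N /\
    (C = hull F `&` hyp_slice j \/ C = hull F `&` slab_slice j).

Definition sliced_radius_le (C : set 'rV[R]_(d + 1)) (r : R) : Prop :=
  exists F, [/\ is_rhomboid F, C `<=` hull F,
    (forall F', is_rhomboid F' -> C `<=` hull F' -> (adim F <= adim F')%N) &
    rhomb_radius F <= r].

(* k_C >= k : the minimum depth of the vertices of the polytope C is >= k,
   equivalently every point of C has depth >= k *)
Definition sliced_depth_ge (C : set 'rV[R]_(d + 1)) (k : nat) : Prop :=
  forall x, C x -> k%:R <= depth x.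

Definition SRhomb (r : R) (k : nat) : set 'rV[R]_(d + 1) :=
  [set x | exists C, [/\ is_sliced_rhomboid C, C x, sliced_radius_le C r &
                        sliced_depth_ge C k]].

Definition Ball (r : R) (At : {set 'I_n}) : set 'rV[R]_d :=
  [set b | forall i, i \in At -> edist b (a i) <= r].

Definition Vor (At : {set 'I_n}) : set 'rV[R]_d :=
  [set b | forall i j, i \in At -> j \notin At -> edist b (a i) <= edist b (a j)].

Definition SDel_simplex (r : R) (k : nat) (sigma : {set {set 'I_n}}) : Prop :=
  exists i, [/\ (k <= i)%N,
    (forall v, v \in sigma -> #|v| = i \/ #|v| = i.+1) &
    exists b, forall v, v \in sigma -> Ball r v b /\ Vor v b].

(* geometric realization of an abstract simplicial complex with vertex set
   {set 'I_n}, inside R^{#|{set 'I_n}|} (vertex v <-> basis vector enum_rank v) *)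
Definition realize (K : {set {set 'I_n}} -> Prop) : set 'rV[R]_#|{set 'I_n}| :=
  [set x | exists sigma, [/\ K sigma, (forall j, 0 <= x 0 j),
      (forall v, v \notin sigma -> x 0 (enum_rank v) = 0) &
      \sum_j x 0 j = 1]].

Definition SDel (r : R) (k : nat) : set 'rV[R]_#|{set 'I_n}| :=
  realize (SDel_simplex r k).
End Sites.

Section Bifiltrations.
Variable R : realType.

Record bifilt := Bifilt { bf_space : topologicalType;
                          bf_X : R -> nat -> set bf_space }.
Arguments bf_X : clear implicits.

Definition is_bifilt (X : bifilt) : Prop :=
  forall r r' k k', 0 <= r -> r <= r' -> (0 < k')%N -> (k' <= k)%N ->
    bf_X X r k `<=` bf_X X r' k'.

Definition hequiv {T U : topologicalType} (A : set T) (B : set U) (f : T -> U) : Prop :=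
  [/\ {within A, continuous f}, f @` A `<=` B &
   exists g : U -> T, [/\ {within B, continuous g}, g @` B `<=` A,
     (exists H : R * T -> T,
        [/\ {within [set p | 0 <= p.1 <= 1 /\ A p.2], continuous H},
            (forall p, 0 <= p.1 <= 1 -> A p.2 -> A (H p)) &
            forall x, A x -> H (0, x) = g (f x) /\ H (1, x) = x]) &
     (exists H : R * U -> U,
        [/\ {within [set p | 0 <= p.1 <= 1 /\ B p.2], continuous H},
            (forall p, 0 <= p.1 <= 1 -> B p.2 -> B (H p)) &
            forall y, B y -> H (0, y) = f (g y) /\ H (1, y) = y])]].

Definition obj_hequiv (X Y : bifilt) (f : R -> nat -> bf_space X -> bf_space Y) : Prop :=
  (forall r k, 0 <= r -> (0 < k)%N -> hequiv (bf_X X r k) (bf_X Y r k) (f r k)) /\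
  (forall r r' k k', 0 <= r -> r <= r' -> (0 < k')%N -> (k' <= k)%N ->
     forall x, bf_X X r k x -> f r' k' x = f r k x).
Arguments obj_hequiv : clear implicits.

Inductive weakly_equivalent : bifilt -> bifilt -> Prop :=
| weq_refl X : is_bifilt X -> weakly_equivalent X X
| weq_fwd X Y Z : is_bifilt X -> (exists f, obj_hequiv X Y f) ->
    weakly_equivalent Y Z -> weakly_equivalent X Z
| weq_bwd X Y Z : is_bifilt X -> (exists f, obj_hequiv Y X f) ->
    weakly_equivalent Y Z -> weakly_equivalent X Z.
End Bifiltrations.
Arguments bf_X {R} b _ _.
Arguments bf_space {R} b.

Definition SRhomb_bifilt (R : realType) (d n : nat) (a : 'I_n -> 'rV[R]_d) : bifilt R :=
  @Bifilt R 'rV[R]_(d + 1) (SRhomb a).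

Definition SDel_bifilt (R : realType) (d n : nat) (a : 'I_n -> 'rV[R]_d) : bifilt R :=
  @Bifilt R 'rV[R]_#|{set 'I_n}| (SDel a).

(* Main.v *)
(** Sending a vertex to its embedding extends linearly to one map f, the
    barycentre map, and f carries the whole bifiltration S-Del to S-Rhomb; it
    suffices that f : S-Del_{r,k} -> S-Rhomb_{r,k} is a homotopy equivalence
    for all r and k.  The vertices of a rhomboid are the subsets of minimal
    total power with respect to its sphere, so complementary slackness forces
    two representations of the same point to be carried by a common rhomboid
    and by the same two levels.  Hence f is onto with convex fibres, and any
    two points of a fibre lie in a common simplex.  This makes the element of
    least Euclidean norm of the fibre a continuous section g of f, and the
    straight-line homotopy inside the fibres connects g o f to the identity. *)

From HB Require Import structures.
From mathcomp Require Import all_boot all_order all_algebra.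
From mathcomp Require Import all_classical all_reals all_analysis.
From mathcomp Require Import ring lra.
Require Import Defs.
Set Implicit Arguments. Unset Strict Implicit. Unset Printing Implicit Defensive.
Import Order.TTheory GRing.Theory Num.Theory.
Import numFieldNormedType.Exports.
Local Open Scope classical_set_scope.
Local Open Scope ring_scope.

(** * Powers and rhomboids *)

Lemma max0D (R : realDomainType) (x : R) : Num.max 0 x = x + Num.max 0 (- x).
Proof. by case: (leP 0 x) => ?; case: (leP 0 (- x)) => ?; lra. Qed.

Section Power.
Context (R : realType) (d n : nat) (a : 'I_n -> 'rV[R]_d).
Implicit Types (c : 'rV[R]_d) (rho : R) (v : {set 'I_n}) (F : {set {set 'I_n}}).

Definition sqdist (x y : 'rV[R]_d) : R := \sum_(j < d) (x 0 j - y 0 j) ^+ 2.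

Lemma sqdist_ge0 x y : 0 <= sqdist x y.
Proof. by apply: sumr_ge0 => j _; exact: sqr_ge0. Qed.

Lemma sqdistC x y : sqdist x y = sqdist y x.
Proof. by apply: eq_bigr => j _; rewrite -sqrrN opprB. Qed.

Lemma edistC (x y : 'rV[R]_d) : edist x y = edist y x.
Proof. by rewrite /edist -!/(sqdist _ _) sqdistC. Qed.

Lemma edist_ge0 (x y : 'rV[R]_d) : 0 <= edist x y.
Proof. exact: sqrtr_ge0. Qed.

Lemma edist_sqr (x y : 'rV[R]_d) : edist x y ^+ 2 = sqdist x y.
Proof. by rewrite sqr_sqrtr// sqdist_ge0. Qed.

(** The power of a site with respect to a sphere: it has the sign of distance minus radius, but is
    polynomial, so it can be summed over a vertex and interpolated between spheres. *)
Definition power c rho (i : 'I_n) : R := sqdist (a i) c - rho ^+ 2.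

Lemma power_le0 c rho i : 0 <= rho -> (power c rho i <= 0) = (edist (a i) c <= rho).
Proof.
by move=> r0; rewrite subr_le0 -edist_sqr ler_pXn2r// nnegrE ?edist_ge0.
Qed.

Lemma power_ge0 c rho i : 0 <= rho -> (0 <= power c rho i) = (rho <= edist (a i) c).
Proof.
by move=> r0; rewrite subr_ge0 -edist_sqr ler_pXn2r// nnegrE ?edist_ge0.
Qed.

Lemma comb_rhombP c rho v :
  reflect ((forall i, i \in v -> edist (a i) c <= rho) /\
           (forall i, i \notin v -> rho <= edist (a i) c))
          (v \in comb_rhomb a c rho).
Proof.
apply: (iffP imsetP) => [[Q]|[vin vout]].
  rewrite powersetE => /fintype.subsetP QF ->; split=> i.
    rewrite !inE => /orP[/ltW//|/QF]; first by rewrite inE => /eqP->.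
  by rewrite !inE negb_or -leNgt => /andP[].
exists (v :&: A_on a c rho); first by rewrite powersetE subsetIr.
apply/setP => i; rewrite !inE; have [iv|iv] := boolP (i \in v).
  by rewrite /= orbC -le_eqVlt vin.
by rewrite /= orbF ltNge vout.
Qed.

Lemma comb_rhomb_powerP c rho v : 0 <= rho ->
  reflect ((forall i, i \in v -> power c rho i <= 0) /\
           (forall i, i \notin v -> 0 <= power c rho i))
          (v \in comb_rhomb a c rho).
Proof.
move=> r0; apply: (iffP (comb_rhombP c rho v)) => -[vin vout]; split=> i iv.
- by rewrite power_le0// vin.
- by rewrite power_ge0// vout.
- by rewrite -power_le0// vin.
- by rewrite -power_ge0// vout.
Qed.

(** This is the excess of the total power of [v] over its minimum among all subsets: a minimiser
    takes every site of negative power and none of positive power. *)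
Definition gap c rho v : R :=
  \sum_i (if i \in v then Num.max 0 (power c rho i)
          else Num.max 0 (- power c rho i)).

Lemma gap_ge0 c rho v : 0 <= gap c rho v.
Proof. by apply: sumr_ge0 => i _; case: ifP => _; rewrite le_max lexx. Qed.

Lemma gap_eq0 c rho v : 0 <= rho ->
  (gap c rho v == 0) = (v \in comb_rhomb a c rho).
Proof.
move=> r0; rewrite psumr_eq0; last first.
  by move=> i _; case: ifP => _; rewrite le_max lexx.
apply/allP/comb_rhomb_powerP => // [gap0|[vin vout] i _].
  split=> i iv; have := gap0 i (mem_index_enum i).
    by rewrite iv /= => /eqP/max_idPl.
  by rewrite (negPf iv) /= => /eqP/max_idPl; rewrite oppr_le0.
apply/eqP; case: ifPn => iv; apply/max_idPl; first exact: vin.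
by rewrite oppr_le0 vout.
Qed.

Lemma emb_lshift v (j : 'I_d) : emb a v 0 (lshift 1 j) = \sum_(i in v) a i 0 j.
Proof. by rewrite /emb row_mxEl summxE. Qed.

Lemma emb_rshift v : emb a v 0 (rshift d ord0) = - #|v|%:R.
Proof. by rewrite /emb row_mxEr mxE. Qed.

(* The lifting sum_(i in v) |a_i|^2 does not depend on the sphere, and the
   gap differs from it by a function that is affine in emb v. *)
Lemma gapE c rho v : gap c rho v =
  \sum_(i in v) sqdist (a i) 0
  - 2 * \sum_j c 0 j * emb a v 0 (lshift 1 j)
  - (sqdist 0 c - rho ^+ 2) * emb a v 0 (rshift d ord0)
  + \sum_i Num.max 0 (- power c rho i).
Proof.
have -> : \sum_j c 0 j * emb a v 0 (lshift 1 j) = \sum_(i in v) dotp c (a i).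
  rewrite exchange_big; apply: eq_bigr => j _.
  by rewrite emb_lshift mulr_sumr.
rewrite emb_rshift mulrN opprK mulr_sumr -sumrB.
rewrite -sum1_card natr_sum mulr_sumr -big_split /=.
rewrite /gap (bigID (mem v)) /= [X in _ = _ + X](bigID (mem v)) /= addrA.
congr (_ + _); last by apply: eq_bigr => i /negPf->.
(* On [v], [max0D] splits off the power itself and leaves the same term as outside [v], so the
   remainder is a constant over all sites. *)
rewrite -big_split /=; apply: eq_bigr => i ->.
rewrite max0D; congr (_ + _); rewrite mulr1 /power addrA; congr (_ - _).
rewrite /power /sqdist /dotp mulr_sumr -sumrB -big_split /=; apply: eq_bigr => j _.
by rewrite !mxE; ring.
Qed.

Definition bary (w : {set 'I_n} -> R) : 'rV[R]_(d + 1) := \sum_v w v *: emb a v.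

Lemma baryE w j : bary w 0 j = \sum_v w v * emb a v 0 j.
Proof. by rewrite summxE; apply: eq_bigr => v _; rewrite mxE. Qed.

Lemma depth_bary w : depth (bary w) = \sum_v w v * #|v|%:R.
Proof.
rewrite /depth baryE -sumrN; apply: eq_bigr => v _.
by rewrite emb_rshift mulrN opprK.
Qed.

Definition mean_gap c rho (w : {set 'I_n} -> R) := \sum_v w v * gap c rho v.

(** By [gapE] everything but the lifting is affine in the embedded vertex, so its mean depends on
    the barycentre only and cancels. The right-hand side is free of the sphere, which lets two
    spheres be compared. *)
Lemma mean_gapB c rho w w' :
  \sum_v w v = 1 -> \sum_v w' v = 1 -> bary w = bary w' ->
  mean_gap c rho w - mean_gap c rho w' =
  \sum_v w v * (\sum_(i in v) sqdist (a i) 0) -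
  \sum_v w' v * (\sum_(i in v) sqdist (a i) 0).
Proof.
move=> w1 w'1 ww'.
suff mgE u : \sum_v u v = 1 -> mean_gap c rho u =
    \sum_v u v * (\sum_(i in v) sqdist (a i) 0)
    - 2 * \sum_j c 0 j * bary u 0 (lshift 1 j)
    - (sqdist 0 c - rho ^+ 2) * bary u 0 (rshift d ord0)
    + \sum_i Num.max 0 (- power c rho i).
  by rewrite (mgE w)// (mgE w')// ww'; lra.
move=> u1; set K := \sum_i Num.max _ _.
have -> : K = \sum_v u v * K by rewrite -mulr_suml u1 mul1r.
rewrite baryE.
under [X in 2 * X]eq_bigr => j _ do rewrite baryE mulr_sumr.
rewrite exchange_big /= !mulr_sumr -!sumrB -big_split /=.
apply: eq_bigr => v _; rewrite gapE !mulrDr !mulrN; congr (_ - _ - _ + _).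
  rewrite !mulr_sumr; apply: eq_bigr => j _; ring.
by ring.
Qed.

(* Complementary slackness: the representations of a point of the hull of a
   rhomboid are exactly those of least mean lifting. *)
Lemma comb_rhomb_slack c rho c' rho' w w' :
  0 <= rho -> 0 <= rho' ->
  (forall v, 0 <= w v) -> (forall v, 0 <= w' v) ->
  \sum_v w v = 1 -> \sum_v w' v = 1 -> bary w = bary w' ->
  (forall v, w v != 0 -> v \in comb_rhomb a c rho) ->
  (forall v, w' v != 0 -> v \in comb_rhomb a c' rho') ->
  forall v, w' v != 0 -> v \in comb_rhomb a c rho.
Proof.
move=> r0 r'0 w0 w'0 w1 w'1 ww' wF wF' v w'v.
have mg0 e s u : 0 <= s -> (forall v, u v != 0 -> v \in comb_rhomb a e s) ->
    mean_gap e s u = 0.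
  move=> s0 uF; apply: big1 => x _; have [->|/uF] := eqVneq (u x) 0.
    by rewrite mul0r.
  by rewrite -gap_eq0// => /eqP->; rewrite mulr0.
have mg_ge0 e s u : (forall v, 0 <= u v) -> 0 <= mean_gap e s u.
  by move=> u0; apply: sumr_ge0 => x _; rewrite mulr_ge0// gap_ge0.
(* The two differences coincide, so minus the mean gap of [w'] for the first sphere equals the mean
   gap of [w] for the second; both mean gaps are nonnegative, hence zero. *)
have := mean_gapB c rho w1 w'1 ww'; have := mean_gapB c' rho' w1 w'1 ww'.
rewrite (mg0 c rho w)// (mg0 c' rho' w')// => e1 e2.
have : mean_gap c rho w' = 0.
  apply/eqP; rewrite eq_le mg_ge0// andbT.
  by have := mg_ge0 c' rho' w w0; lra.
move/eqP; rewrite psumr_eq0; last by move=> x _; rewrite mulr_ge0// gap_ge0.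
move=> /allP/(_ v (mem_index_enum v)) /=.
by rewrite mulf_eq0 (negPf w'v) gap_eq0.
Qed.

(** The squared distance to a convex combination of centres falls short of the interpolated one by
    [l * (1 - l) * sqdist c c']; the condition on [rho''] compensates exactly this (a pencil of
    spheres). *)
Lemma power_conv c rho c' rho' (l : R) rho'' i :
  rho'' ^+ 2 = (1 - l) * rho ^+ 2 + l * rho' ^+ 2 - l * (1 - l) * sqdist c c' ->
  power ((1 - l) *: c + l *: c') rho'' i =
  (1 - l) * power c rho i + l * power c' rho' i.
Proof.
rewrite /power => ->; rewrite !mulrBr.
suff -> : sqdist (a i) ((1 - l) *: c + l *: c') =
  (1 - l) * sqdist (a i) c + l * sqdist (a i) c' - l * (1 - l) * sqdist c c'.
  by ring.
rewrite /sqdist !mulr_sumr -big_split -sumrB /=; apply: eq_bigr => j _.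
by rewrite !mxE; ring.
Qed.

(* A point moving from one centre slightly towards the other, with squared
   radii interpolated so that powers interpolate linearly. *)
Lemma comb_rhombI c rho c' rho' v0 eps :
  0 < rho -> 0 <= rho' -> 0 < eps ->
  v0 \in comb_rhomb a c rho -> v0 \in comb_rhomb a c' rho' ->
  exists c'' rho'', [/\ 0 < rho'', rho'' <= rho + eps &
    comb_rhomb a c'' rho'' = comb_rhomb a c rho :&: comb_rhomb a c' rho'].
Proof.
move=> r0 r'0 e0.
move=> /(comb_rhomb_powerP _ _ (ltW r0))[in0 out0].
move=> /(comb_rhomb_powerP _ _ r'0)[in0' out0'].
(* The new squared radius [s] differs from [rho ^+ 2] by at most [l * M]. The bound [rho ^+ 2 / 2]
   on [l * M] keeps [s] positive, and [eps * rho] keeps it below [(rho + eps) ^+ 2]. *)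
pose M := rho ^+ 2 + rho' ^+ 2 + sqdist c c'.
have M0 : 0 < M by rewrite ltr_wpDr ?sqdist_ge0// ltr_wpDr ?sqr_ge0// exprn_gt0.
pose m := Num.min (rho ^+ 2 / 2) (eps * rho).
have m0 : 0 < m by rewrite lt_min divr_gt0 ?exprn_gt0// mulr_gt0.
have m1 : m <= rho ^+ 2 / 2 by rewrite ge_min lexx.
have m2 : m <= eps * rho by rewrite ge_min lexx orbT.
pose l := Num.min (1 / 2) (m / M).
have l0 : 0 < l by rewrite lt_min !divr_gt0.
have l1 : l <= 1 / 2 by rewrite ge_min lexx.
have lM : l * M <= m by rewrite -ler_pdivlMr// ge_min lexx orbT.
have D0 := sqdist_ge0 c c'.
have l1D : 0 <= l * l * sqdist c c' by rewrite !mulr_ge0// ltW.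
have lr : 0 <= l * rho ^+ 2 by rewrite mulr_ge0 ?sqr_ge0// ltW.
have lr' : 0 <= l * rho' ^+ 2 by rewrite mulr_ge0 ?sqr_ge0// ltW.
have lD : 0 <= l * sqdist c c' by rewrite mulr_ge0 // ltW.
pose s := (1 - l) * rho ^+ 2 + l * rho' ^+ 2 - l * (1 - l) * sqdist c c'.
have rr0 : 0 < rho ^+ 2 by rewrite exprn_gt0.
have s0 : 0 < s by rewrite /s; move: lM; rewrite /M; nra.
have sle : s <= (rho + eps) ^+ 2.
  have ee0 : 0 <= eps ^+ 2 by rewrite sqr_ge0.
  by rewrite /s; move: lM; rewrite /M; nra.
exists ((1 - l) *: c + l *: c'), (Num.sqrt s); split.
- by rewrite sqrtr_gt0.
- by rewrite -(ger0_norm (ltW (addr_gt0 r0 e0))) -sqrtr_sqr ler_wsqrtr.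
apply/setP => v; rewrite inE.
have pE i : power ((1 - l) *: c + l *: c') (Num.sqrt s) i =
    (1 - l) * power c rho i + l * power c' rho' i.
  by apply: power_conv; rewrite sqr_sqrtr// ltW.
(* The common vertex [v0] prevents cancellation: both powers of a site are nonpositive if it lies in
   [v0] and nonnegative otherwise, so a sign condition on their positive combination passes to each
   of them. *)
apply/comb_rhomb_powerP/andP; rewrite ?sqrtr_ge0//.
- case=> vin vout; split; apply/comb_rhomb_powerP; rewrite ?(ltW r0)//; split=> i iv.
  + have := vin i iv; rewrite pE.
    have [i0|i0] := boolP (i \in v0); first by move=> _; exact: in0.
    by have := out0 i i0; have := out0' i i0; nra.
  + have := vout i iv; rewrite pE.
    have [i0|i0] := boolP (i \in v0); last by move=> _; exact: out0.
    by have := in0 i i0; have := in0' i i0; nra.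
  + have := vin i iv; rewrite pE.
    have [i0|i0] := boolP (i \in v0); first by move=> _; exact: in0'.
    by have := out0 i i0; have := out0' i i0; nra.
  + have := vout i iv; rewrite pE.
    have [i0|i0] := boolP (i \in v0); last by move=> _; exact: out0'.
    by have := in0 i i0; have := in0' i i0; nra.
- case=> /(comb_rhomb_powerP _ _ (ltW r0))[vin vout].
  move=> /(comb_rhomb_powerP _ _ r'0)[vin' vout']; split=> i iv; rewrite pE.
  + by have := vin i iv; have := vin' i iv; nra.
  + by have := vout i iv; have := vout' i iv; nra.
Qed.

Lemma is_rhomboidI F F' v0 : is_rhomboid a F -> is_rhomboid a F' ->
  v0 \in F -> v0 \in F' -> is_rhomboid a (F :&: F').
Proof.
move=> [c [rho [r0 <-]]] [c' [rho' [r'0 <-]]] vF vF'.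
have [c'' [rho'' [r''0 _ E]]] := comb_rhombI r0 (ltW r'0) ltr01 vF vF'.
by exists c'', rho''.
Qed.

Lemma rhomb_radius_le c rho : 0 < rho ->
  rhomb_radius a (comb_rhomb a c rho) <= rho.
Proof.
move=> r0; apply: ge_inf; last by exists c.
by exists 0 => x [e [/ltW]].
Qed.

(** Any sphere of [F] can be tilted towards one of [F'] at the cost of an arbitrarily small [eps] in
    the radius. *)
Lemma rhomb_radiusI F F' v0 : is_rhomboid a F -> is_rhomboid a F' ->
  v0 \in F -> v0 \in F' -> rhomb_radius a (F :&: F') <= rhomb_radius a F.
Proof.
move=> [c0 [rho0 [r00 E0]]] [c' [rho' [r'0 <-]]] vF vF'.
apply: lb_le_inf; first by exists rho0, c0.
move=> rho [c [r0 E]]; apply/ler_addgt0Pr => eps e0; rewrite -E in vF *.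
have [c'' [rho'' [r''0 le'' <-]]] := comb_rhombI r0 (ltW r'0) e0 vF vF'.
exact: le_trans (rhomb_radius_le _ _) le''.
Qed.

End Power.

(** * Spheres carrying a simplex; radii *)

Section Simplices.
Context (R : realType) (d n : nat) (a : 'I_n -> 'rV[R]_d).
Implicit Types (c b : 'rV[R]_d) (r rho : R) (v : {set 'I_n}) (F sigma : {set {set 'I_n}}).

(** Take for [rho] the distance from [b] to the farthest site occurring in [sigma], a member of some
    vertex [v0]. If a site [j] outside [v] were strictly nearer, all of [j |: v] would be; as the
    levels are consecutive, this set is at least as large as [v0], so it has an element outside
    [v0], against the Voronoi condition of [v0]. *)
Lemma SDel_simplex_comb_rhomb r b i sigma :
  (0 < i)%N -> sigma != finset.set0 ->
  (forall v, v \in sigma -> #|v| = i \/ #|v| = i.+1) ->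
  (forall v, v \in sigma -> Ball a r v b /\ Vor a v b) ->
  exists rho, [/\ 0 <= rho, rho <= r & {subset sigma <= comb_rhomb a b rho}].
Proof.
move=> i0 /set0Pn[v1 v1s] card bv.
have [l1 l1v1] : exists l, l \in v1.
  by apply/set0Pn; rewrite -card_gt0; case: (card _ v1s) => ->.
pose U : pred 'I_n := fun l => [exists v in sigma, l \in v].
have l1U : U l1 by apply/exists_inP; exists v1.
case: (@arg_maxP _ _ _ l1 U (fun l => edist (a l) b) l1U) => l0 /= l0U lmax.
have /exists_inP[v0 v0s l0v0] := l0U.
exists (edist (a l0) b); split; first exact: edist_ge0.
  by rewrite edistC; have [bb _] := bv _ v0s; exact: bb.
move=> v vs; apply/comb_rhombP; split=> [l lv|j jv].
  by apply: lmax; apply/exists_inP; exists v.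
rewrite leNgt; apply/negP => jl0.
have near l : l \in j |: v -> edist (a l) b < edist (a l0) b.
  rewrite in_setU1 => /orP[/eqP->//|lv].
  have [_ Vv] := bv _ vs; apply: le_lt_trans jl0.
  by rewrite !(edistC _ b); exact: Vv.
have [l lj lv0] : exists2 l, l \in j |: v & l \notin v0.
  apply/subsetPn; apply/negP => sub; have : l0 \in j |: v.
    suff -> : j |: v = v0 by [].
    apply/eqP; rewrite eqEcard sub cardsU1 jv /=.
    by case: (card _ vs) => ->; case: (card _ v0s) => ->; rewrite add1n ?leqnSn ?leqnn ?leqW.
  by move=> /near; rewrite ltxx.
have [_ V0] := bv _ v0s; have := V0 _ _ l0v0 lv0.
by rewrite !(edistC b) leNgt near.
Qed.

Lemma comb_rhomb_Ball c rho r v : v \in comb_rhomb a c rho -> rho <= r ->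
  Ball a r v c /\ Vor a v c.
Proof.
move=> /comb_rhombP[vin vout] rr; split=> [i iv|i j iv jv]; rewrite edistC.
  exact: le_trans (vin _ iv) rr.
by rewrite (edistC c); exact: le_trans (vin _ iv) (vout _ jv).
Qed.

Lemma exists_pos_lb (T : finType) (P : pred T) (f : T -> R) :
  (forall t, P t -> 0 < f t) -> exists2 e : R, 0 < e & forall t, P t -> e < f t.
Proof.
move=> f0; exists ((\big[Num.min/1]_(t | P t) f t) / 2).
  by rewrite divr_gt0//; elim/big_ind: _ => // x y x0 y0; rewrite lt_min x0.
move=> t Pt; have m0 : 0 < \big[Num.min/1]_(t | P t) f t.
  by elim/big_ind: _ => // x y x0 y0; rewrite lt_min x0.
have : \big[Num.min/1]_(t | P t) f t <= f t by apply: bigmin_le_cond.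
by lra.
Qed.

(* The closed condition {subset sigma <= comb_rhomb a b rho} only defines a
   rhomboid for rho > 0; for rho = 0 one takes small spheres around the site b. *)
Lemma comb_rhomb_is_rhomboid b rho r sigma : injective a ->
  0 <= rho -> rho <= r -> (forall v, v \in sigma -> v != finset.set0) ->
  {subset sigma <= comb_rhomb a b rho} ->
  exists F, [/\ is_rhomboid a F, {subset sigma <= F} & rhomb_radius a F <= r].
Proof.
move=> inja rho0 rhor sigma0 sub.
have [rho_gt0|rho_le0] := ltP 0 rho.
  exists (comb_rhomb a b rho); split=> //; first by exists b, rho.
  exact: le_trans (rhomb_radius_le _ _ rho_gt0) rhor.
have {}rho0 : rho = 0 by apply/eqP; rewrite eq_le rho_le0.
rewrite {}rho0 in sub rhor.
have [e e0 eP] : exists2 e : R, 0 < e &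
    forall i, edist (a i) b != 0 -> e < edist (a i) b.
  by apply: exists_pos_lb => i ai; rewrite lt_def ai edist_ge0.
(* Sites not at [b] are farther than [e], so all smaller spheres around [b] give one rhomboid, whose
   radius is therefore at most 0. *)
have FE s : 0 < s -> s <= e ->
    comb_rhomb a b s = comb_rhomb a b e.
  move=> s0 se; apply/setP => v; apply/comb_rhombP/comb_rhombP => -[vin vout]; split=> i iv.
  - exact: le_trans (vin i iv) se.
  - have := vout i iv; have [->|/eP/ltW//] := eqVneq (edist (a i) b) 0.
    by move=> /(lt_le_trans s0); rewrite ltxx.
  - have := vin i iv; have [->|/eP] := eqVneq (edist (a i) b) 0.
      by move=> _; exact: ltW.
    by move=> /lt_le_trans h /h; rewrite ltxx.
  - exact: le_trans se (vout i iv).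
exists (comb_rhomb a b e); split; first by exists b, e.
  move=> v vs; have /set0Pn[i iv] := sigma0 _ vs.
  have /comb_rhombP[vin vout] := sub _ vs.
  have edist0 l : l \in v -> edist (a l) b = 0.
    by move=> lv; apply/eqP; rewrite eq_le vin// edist_ge0.
  have edist_eq0 l : edist (a l) b = 0 -> a l = b.
    move=> /eqP; rewrite sqrtr_eq0 => h; apply/rowP => j.
    apply/eqP; rewrite -subr_eq0 -sqrf_eq0; apply/eqP.
    have sq0 (m : 'I_d) : true -> 0 <= (a l 0 m - b 0 m) ^+ 2 by rewrite sqr_ge0.
    by apply: (psumr_eq0P sq0) => //; apply/eqP; rewrite eq_le h sumr_ge0.
  apply/comb_rhombP; split=> [l lv|j jv]; first by rewrite edist0// ltW.
  (* Sites are distinct, so the site [i] of [v] is the only one located at [b]. *)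
  apply/ltW/eP; apply: contra jv => /eqP/edist_eq0 ajb.
  suff -> : j = i by [].
  by apply: inja; rewrite ajb edist_eq0// edist0.
apply/ler_addgt0Pr => x x0; apply: le_trans (_ : x <= _); last by rewrite lerDr.
have m0 : 0 < Num.min e x by rewrite lt_min e0.
rewrite -(FE (Num.min e x))// ?ge_min ?lexx//.
apply: le_trans (rhomb_radius_le _ _ m0) _.
by rewrite ge_min lexx orbT.
Qed.

Lemma is_rhomboid_slack F F' (w w' : {set 'I_n} -> R) :
  is_rhomboid a F -> is_rhomboid a F' ->
  (forall v, 0 <= w v) -> (forall v, 0 <= w' v) ->
  \sum_v w v = 1 -> \sum_v w' v = 1 -> bary a w = bary a w' ->
  (forall v, v \notin F -> w v = 0) -> (forall v, v \notin F' -> w' v = 0) ->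
  forall v, v \notin F -> w' v = 0.
Proof.
move=> [c [rho [r0 <-]]] [c' [rho' [r'0 <-]]] w0 w'0 w1 w'1 ww' wF wF' v.
have supp F0 (u : {set 'I_n} -> R) : (forall v, v \notin F0 -> u v = 0) ->
    forall v, u v != 0 -> v \in F0.
  by move=> h x; apply: contraR => /h/eqP.
apply: contraNeq; apply: (comb_rhomb_slack (w := w) (c' := c') (rho' := rho')) => //.
- exact: ltW.
- exact: ltW.
- exact: supp wF.
- exact: supp wF'.
Qed.

(** The rhomboids meet face to face: by slackness, weights carried by [F] are carried by [F'] as
    soon as their barycentre lies in the hull of [F']. *)
Lemma hullI F F' : is_rhomboid a F -> is_rhomboid a F' ->
  hull a F `&` hull a F' `<=` hull a (F :&: F').
Proof.
move=> rF rF' x [[w [w0 [wF [w1 ->]]]] [w' [w'0 [wF' [w'1 ww']]]]].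
exists w; split=> //; split=> // v; rewrite inE negb_and => /orP[/wF//|].
exact: (is_rhomboid_slack rF' rF w'0 w0 w'1 w1 (esym ww') wF' wF).
Qed.

Lemma hull_mem F x : hull a F x -> exists v, v \in F.
Proof.
move=> [w [w0 [wF [w1 _]]]]; have [F0|/set0Pn[v vF]] := eqVneq F finset.set0.
  by move: w1; rewrite big1 => [|v _]; [move/esym/eqP; rewrite oner_eq0|
    apply: wF; rewrite F0 inE].
by exists v.
Qed.

Lemma adim_sub F F' : {subset F <= F'} -> (adim a F <= adim a F')%N.
Proof.
move=> FF'; rewrite /adim -!subn1 leq_sub2r// mxrankS//.
apply/row_subP => i; rewrite rowK.
have vF' : enum_val i \in F' by apply: FF'; exact: enum_valP.
have -> : row_mx (emb a (enum_val i)) 1 = row (enum_rank_in vF' (enum_val i))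
    (\matrix_(i < #|F'|) row_mx (emb a (enum_val i)) (1 : 'rV[R]_1)).
  by rewrite rowK enum_rankK_in.
exact: row_sub.
Qed.

(** A rhomboid [F'] of least dimension around [C] may have nothing to do with [F], so it is
    intersected with [F]: this keeps [C] inside, does not raise the dimension, and inherits the
    radius bound from [F]. A point of [C] supplies the common vertex. *)
Lemma sliced_radius_le_hull F (C : set 'rV[R]_(d + 1)) r :
  is_rhomboid a F -> C `<=` hull a F -> C !=set0 -> rhomb_radius a F <= r ->
  sliced_radius_le a C r.
Proof.
move=> rF CF [x Cx] Fr.
pose P m := `[< exists F', [/\ is_rhomboid a F', C `<=` hull a F' & adim a F' = m] >].
have exP : exists m, P m by exists (adim a F); apply/asboolP; exists F.
case: (ex_minnP exP) => m /asboolP[F' [rF' CF' adimF']] mmin.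
have CFF' : C `<=` hull a (F :&: F').
  by move=> y Cy; apply: hullI => //; split; [exact: CF|exact: CF'].
have [v] := hull_mem (CFF' _ Cx); rewrite inE => /andP[vF vF'].
exists (F :&: F'); split => //.
- exact: is_rhomboidI vF vF'.
- move=> F'' rF'' CF''; apply: (@leq_trans m); last first.
    by apply: mmin; apply/asboolP; exists F''.
  by rewrite -adimF'; apply: adim_sub => u; rewrite inE => /andP[].
- exact: le_trans (rhomb_radiusI rF rF' vF vF') Fr.
Qed.

End Simplices.

(** * Levels *)

Section Levels.
Context (R : realType) (d n : nat) (a : 'I_n -> 'rV[R]_d).
Implicit Types (r rho : R) (v : {set 'I_n}) (F sigma tau : {set {set 'I_n}}).
Implicit Types (w : {set 'I_n} -> R).

Definition weight (y : 'rV[R]_#|{set 'I_n}|) : {set 'I_n} -> R :=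
  fun v => y 0 (enum_rank v).

Lemma sum_weight (y : 'rV[R]_#|{set 'I_n}|) (g : {set 'I_n} -> R) :
  \sum_v weight y v * g v = \sum_j y 0 j * g (enum_val j).
Proof.
rewrite (reindex (@enum_val _ (mem {set 'I_n}))) /=; last first.
  by apply: onW_bij; exact: enum_val_bij.
by apply: eq_bigr => j _; rewrite /weight enum_valK.
Qed.

Lemma sum_weight1 (y : 'rV[R]_#|{set 'I_n}|) : \sum_v weight y v = \sum_j y 0 j.
Proof.
have := sum_weight y (fun=> 1).
by under eq_bigr do rewrite mulr1; under [in RHS]eq_bigr do rewrite mulr1.
Qed.

Lemma weight_ge0 (y : 'rV[R]_#|{set 'I_n}|) : (forall j, 0 <= y 0 j) <-> (forall v, 0 <= weight y v).
Proof.
split=> y0 j; first exact: y0.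
by have := y0 (enum_val j); rewrite /weight enum_valK.
Qed.

Lemma weight_row w v : weight (\row_j w (enum_val j)) v = w v.
Proof. by rewrite /weight mxE enum_rankK. Qed.

Definition at_levels i w := forall v, w v != 0 -> #|v| = i \/ #|v| = i.+1.

Lemma convex_const w (m : R) : \sum_v w v = 1 -> m = \sum_v w v * m.
Proof. by move=> w1; rewrite -mulr_suml w1 mul1r. Qed.

Lemma depth_ge i w : (forall v, 0 <= w v) -> \sum_v w v = 1 ->
  (forall v, w v != 0 -> (i <= #|v|)%N) -> i%:R <= depth (bary a w).
Proof.
move=> w0 w1 wi; rewrite depth_bary [leLHS](convex_const _ w1).
apply: ler_sum => v _; have [->|/wi iv] := eqVneq (w v) 0; first by rewrite !mul0r.
by apply: ler_wpM2l; rewrite ?ler_nat.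
Qed.

Lemma depth_le i w : (forall v, 0 <= w v) -> \sum_v w v = 1 ->
  (forall v, w v != 0 -> (#|v| <= i)%N) -> depth (bary a w) <= i%:R.
Proof.
move=> w0 w1 wi; rewrite depth_bary [leRHS](convex_const _ w1).
apply: ler_sum => v _; have [->|/wi iv] := eqVneq (w v) 0; first by rewrite !mul0r.
by apply: ler_wpM2l; rewrite ?ler_nat.
Qed.

Lemma level_top i w : (forall v, 0 <= w v) -> \sum_v w v = 1 ->
  (forall v, w v != 0 -> (#|v| <= i)%N) -> i%:R <= depth (bary a w) ->
  forall v, w v != 0 -> #|v| = i.
Proof.
move=> w0 w1 wi; rewrite depth_bary [leLHS](convex_const _ w1) -subr_le0 -sumrB => le0.
have t0 v : true -> 0 <= w v * i%:R - w v * #|v|%:R.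
  move=> _; have [->|/wi iv] := eqVneq (w v) 0; first by rewrite !mul0r subrr.
  by rewrite subr_ge0; apply: ler_wpM2l; rewrite ?ler_nat.
have /eqP : \sum_v (w v * i%:R - w v * #|v|%:R) = 0.
  by apply/eqP; rewrite eq_le le0 sumr_ge0.
rewrite psumr_eq0// => /allP h v wv; have := h v (mem_index_enum v).
by rewrite /= -mulrBr mulf_eq0 (negPf wv) subr_eq0 eqr_nat => /eqP.
Qed.

Lemma level_bot i w : (forall v, 0 <= w v) -> \sum_v w v = 1 ->
  (forall v, w v != 0 -> (i <= #|v|)%N) -> depth (bary a w) <= i%:R ->
  forall v, w v != 0 -> #|v| = i.
Proof.
move=> w0 w1 wi; rewrite depth_bary [leRHS](convex_const _ w1) -subr_le0 -sumrB => le0.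
have t0 v : true -> 0 <= w v * #|v|%:R - w v * i%:R.
  move=> _; have [->|/wi iv] := eqVneq (w v) 0; first by rewrite !mul0r subrr.
  by rewrite subr_ge0; apply: ler_wpM2l; rewrite ?ler_nat.
have /eqP : \sum_v (w v * #|v|%:R - w v * i%:R) = 0.
  by apply/eqP; rewrite eq_le le0 sumr_ge0.
rewrite psumr_eq0// => /allP h v wv; have := h v (mem_index_enum v).
by rewrite /= -mulrBr mulf_eq0 (negPf wv) subr_eq0 eqr_nat => /eqP.
Qed.

Lemma at_levels_ge i w : at_levels i w -> forall v, w v != 0 -> (i <= #|v|)%N.
Proof. by move=> wi v /wi[->|->]. Qed.

Lemma at_levels_le i w : at_levels i w -> forall v, w v != 0 -> (#|v| <= i.+1)%N.
Proof. by move=> wi v /wi[->|->]. Qed.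

(** The common depth lies in both [[i, i + 1]] and [[i', i' + 1]], so unequal levels are adjacent.
    Then the depth is the shared integer, an extreme value for [w'], and all of [w'] sits on that
    level. *)
Lemma at_levels_shift i i' w w' :
  (forall v, 0 <= w v) -> (forall v, 0 <= w' v) ->
  \sum_v w v = 1 -> \sum_v w' v = 1 -> bary a w = bary a w' ->
  at_levels i w -> at_levels i' w' -> at_levels i w'.
Proof.
move=> w0 w'0 w1 w'1 ww' /[dup] /at_levels_ge ge_i /at_levels_le le_i1 wi' v w'v.
have [ii'|i'i|->] := ltngtP i i'; last exact: wi'.
- right; have [/eqP] : #|v| = i' /\ i' = i.+1; last by move=> /eqP-> ->.
  have i'd := depth_ge w'0 w'1 (at_levels_ge wi').
  have di := depth_le w0 w1 le_i1; rewrite ww' in di.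
  have i'i1 : i' = i.+1.
    by apply/eqP; rewrite eqn_leq ii' -(ler_nat R) (le_trans i'd).
  split=> //; apply: (level_bot w'0 w'1 (at_levels_ge wi') _ w'v).
  by rewrite i'i1.
- left; have [/eqP] : #|v| = i'.+1 /\ i'.+1 = i; last by move=> /eqP-> ->.
  have di' := depth_le w'0 w'1 (at_levels_le wi').
  have id := depth_ge w0 w1 ge_i; rewrite ww' in id.
  have i'i1 : i'.+1 = i.
    by apply/eqP; rewrite eqn_leq i'i -(ler_nat R) (le_trans id).
  split=> //; apply: (level_top w'0 w'1 (at_levels_le wi') _ w'v).
  by rewrite i'i1.
Qed.

(** If [i < k], then [k = i.+1] is the maximal possible depth, so everything sits at level [k],
    which also counts as the lower of the levels [k] and [k.+1]. *)
Lemma at_levels_raise k i w :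
  (forall v, 0 <= w v) -> \sum_v w v = 1 -> k%:R <= depth (bary a w) ->
  at_levels i w -> exists2 j, (k <= j)%N & at_levels j w.
Proof.
move=> w0 w1 kd wi; have [ki|ik] := leqP k i; first by exists i.
have di := depth_le w0 w1 (at_levels_le wi).
have -> : k = i.+1.
  by apply/eqP; rewrite eqn_leq ik -(ler_nat R) (le_trans kd).
exists i.+1 => // v wv; left; apply: (level_top w0 w1 (at_levels_le wi) _ wv).
by apply: le_trans kd; rewrite ler_nat.
Qed.

Lemma SDel_SRhomb (inja : injective a) r k y : (0 < k)%N ->
  SDel a r k y -> SRhomb a r k (bary a (weight y)).
Proof.
move=> k0 [sigma [[i [ki card [b bv]]] y0 ysig y1]].
have w0 := (weight_ge0 y).1 y0.
have w1 : \sum_v weight y v = 1 by rewrite sum_weight1.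
have wsig v : weight y v != 0 -> v \in sigma.
  by apply: contraR => /ysig yv; apply/eqP.
have [v0 v0s] : exists v0, v0 \in sigma.
  apply/set0Pn/negP => /eqP s0; move: w1; rewrite big1 => [/esym/eqP|v _].
    by rewrite oner_eq0.
  by apply: ysig; rewrite s0 inE.
have i0 : (0 < i)%N by exact: leq_trans ki.
have sN0 : sigma != finset.set0 by apply/set0Pn; exists v0.
have [rho [rho0 rhor sub]] := SDel_simplex_comb_rhomb i0 sN0 card bv.
have vN0 v : v \in sigma -> v != finset.set0.
  by move=> /card; rewrite -card_gt0 => -[]->.
have [F [rF sF Fr]] := comb_rhomb_is_rhomboid inja rho0 rhor vN0 sub.
have lev : at_levels i (weight y) by move=> v /wsig /card.
have hx : hull a F (bary a (weight y)).
  exists (weight y); split=> //; split=> // v vF; apply: ysig.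
  by apply: contra vF; exact: sF.
have dx : i%:R <= depth (bary a (weight y)) <= i.+1%:R.
  rewrite depth_ge ?depth_le//; [exact: at_levels_le|exact: at_levels_ge].
(* The cell is the slab between the two levels of [sigma], cut from the rhomboid of a sphere
   carrying [sigma]. *)
exists (hull a F `&` slab_slice i); split.
- exists F, i; split=> //; split; last by right.
  have : (#|v0| <= n)%N by rewrite -[leqRHS]card_ord max_card.
  by apply: leq_trans; case: (card _ v0s) => ->.
- by split.
- apply: (sliced_radius_le_hull rF) => //; by [move=> ? []|exists (bary a (weight y))].
- move=> x [_ /andP[ix _]]; apply: le_trans ix; by rewrite ler_nat.
Qed.

(* By slackness the sphere that carries sigma also carries the support of t. *)
Lemma SDel_simplexU r k sigma (s t : 'rV[R]_#|{set 'I_n}|) : (0 < k)%N ->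
  SDel_simplex a r k sigma ->
  (forall j, 0 <= s 0 j) -> \sum_j s 0 j = 1 ->
  (forall v, v \notin sigma -> weight s v = 0) ->
  SDel a r k t -> bary a (weight s) = bary a (weight t) ->
  exists tau, [/\ SDel_simplex a r k tau, {subset sigma <= tau} &
    forall v, weight t v != 0 -> v \in tau].
Proof.
move=> k0 [i [ki card [b bv]]] s0 s1 ssig [tau [[i' [ki' card' [b' bv']]] t0 ttau t1]] st.
have ws0 := (weight_ge0 s).1 s0; have wt0 := (weight_ge0 t).1 t0.
have ws1 : \sum_v weight s v = 1 by rewrite sum_weight1.
have wt1 : \sum_v weight t v = 1 by rewrite sum_weight1.
have supp (u : {set 'I_n} -> R) F : (forall v, v \notin F -> u v = 0) ->
    forall v, u v != 0 -> v \in F.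
  by move=> h v; apply: contraR => /h ->.
have suppN0 (u : {set 'I_n} -> R) F : \sum_v u v = 1 -> (forall v, v \notin F -> u v = 0) ->
    F != finset.set0.
  move=> u1 uF; apply/negP => /eqP F0; move: u1; rewrite big1 => [/esym/eqP|v _].
    by rewrite oner_eq0.
  by apply: uF; rewrite F0 inE.
have [rho [rho0 rhor sub]] := SDel_simplex_comb_rhomb (leq_trans k0 ki)
  (suppN0 _ _ ws1 ssig) card bv.
have [rho' [rho'0 rhor' sub']] := SDel_simplex_comb_rhomb (leq_trans k0 ki')
  (suppN0 _ _ wt1 ttau) card' bv'.
have tF v : weight t v != 0 -> v \in comb_rhomb a b rho.
  apply: (comb_rhomb_slack (w := weight s) (c' := b') (rho' := rho')) => //.
  - by move=> x /(supp _ _ ssig)/sub.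
  - by move=> x /(supp _ _ ttau)/sub'.
have tlev : at_levels i (weight t).
  apply: (@at_levels_shift i i' (weight s)) => //.
  - by move=> x /(supp _ _ ssig)/card.
  - by move=> x /(supp _ _ ttau)/card'.
exists (sigma :|: [set v | weight t v != 0]%SET); split.
- exists i; split=> //.
    by move=> v; rewrite !inE => /orP[/card//|/tlev].
  exists b => v; rewrite !inE => /orP[/bv//|/tF vF].
  exact: comb_rhomb_Ball vF rhor.
- by move=> v vs; rewrite inE vs.
- by move=> v tv; rewrite !inE tv orbT.
Qed.
End Levels.

(** * Linear maps with joinable fibres *)

Section Topology.
Context (R : realType).

Lemma sum_continuous (T : topologicalType) (V : normedModType R) (I : Type)
    (r : seq I) (f : I -> T -> V) :
  (forall i, continuous (f i)) -> continuous (fun x => \sum_(i <- r) f i x).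
Proof.
by move=> cf; apply: continuous_big => [|i _]; [exact: add_continuous|exact: cf].
Qed.

Lemma linear_rV_continuous N (V : normedModType R) (f : {linear 'rV[R]_N -> V}) :
  continuous f.
Proof.
have -> : (f : _ -> _) = fun y : 'rV[R]_N => \sum_j y 0 j *: f (delta_mx 0 j).
  apply/funext => y; rewrite {1}(row_sum_delta y) linear_sum.
  by apply: eq_bigr => j _; rewrite linearZ.
apply: sum_continuous => j y; apply: (@cvgZr_tmp _ _ _ (nbhs y)); exact: coord_continuous.
Qed.

Lemma closed_forall (T : topologicalType) (I : Type) (P : I -> T -> Prop) :
  (forall i, closed [set x | P i x]) -> closed [set x | forall i, P i x].
Proof.
move=> cP; have -> : [set x | forall i, P i x] = \bigcap_(i in setT) [set x | P i x].
  by apply/seteqP; split=> x /= h i; [move=> _; exact: h|exact: h].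
by apply: closed_bigI => i _; exact: cP.
Qed.

Lemma closed_fun_le (T : topologicalType) (f : T -> R) c :
  continuous f -> closed [set x | f x <= c].
Proof. by move=> /continuous_closedP cf; exact: cf _ (@closed_le _ c). Qed.

Lemma closed_fun_ge (T : topologicalType) (f : T -> R) c :
  continuous f -> closed [set x | c <= f x].
Proof. by move=> /continuous_closedP cf; exact: cf _ (@closed_ge _ c). Qed.

Lemma closed_fun_eq (T : topologicalType) (f : T -> R) c :
  continuous f -> closed [set x | f x = c].
Proof. by move=> /continuous_closedP cf; exact: cf _ (@closed_eq _ c). Qed.

Lemma nbhs_forall (T : topologicalType) (I : finType) (x : T) (P : I -> T -> Prop) :
  (forall i, nbhs x [set y | P i y]) -> nbhs x [set y | forall i, P i y].
Proof. exact: filter_forall. Qed.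

Definition simplex N : set 'rV[R]_N :=
  [set y | (forall j, 0 <= y 0 j) /\ \sum_j y 0 j = 1].

Lemma simplex_le1 N (y : 'rV[R]_N) j : simplex y -> y 0 j <= 1.
Proof.
by move=> [y0 <-]; rewrite (bigD1 j)//= lerDl; apply: sumr_ge0 => i _; exact: y0.
Qed.

Lemma simplex_compact N : compact (@simplex N).
Proof.
have cube := @rV_compact R N (fun=> `[0, 1]%classic) (fun=> @segment_compact R 0 1).
apply: subclosed_compact _ cube _.
  apply: closedI.
    apply: closed_forall => j.
    by apply: closed_fun_ge; exact: coord_continuous.
  by apply: closed_fun_eq; apply: (@sum_continuous _ R^o) => j; exact: coord_continuous.
move=> y /[dup] -[y0 _] Sy j /=; rewrite in_itv /= y0.
exact: simplex_le1.
Qed.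

Lemma simplex_closed N : closed (@simplex N).
Proof. exact: compact_closed (@norm_hausdorff _ _) (@simplex_compact N). Qed.

Definition inner N (x y : 'rV[R]_N) := \sum_j x 0 j * y 0 j.

Lemma inner_continuous N (d : 'rV[R]_N) : continuous (fun x => inner x d).
Proof.
apply: (@sum_continuous _ R^o) => j x.
by apply: (@cvgMr_tmp _ _ (nbhs x)); exact: coord_continuous.
Qed.

Lemma innerxx_continuous N : continuous (fun x : 'rV[R]_N => inner x x).
Proof.
by apply: (@sum_continuous _ R^o) => j x; apply: (@cvgM _ _ (nbhs x)); exact: coord_continuous.
Qed.

Lemma innerxx_eq0 N (x : 'rV[R]_N) : inner x x <= 0 -> x = 0.
Proof.
move=> x0; have sq0 (i : 'I_N) : true -> 0 <= x 0 i * x 0 i.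
  by rewrite -expr2 sqr_ge0.
apply/rowP => j; apply/eqP; rewrite mxE -[_ == _]orbb -mulf_eq0; apply/eqP.
by apply: (psumr_eq0P sq0) => //; apply/eqP; rewrite eq_le x0 sumr_ge0.
Qed.

Lemma inner_addZ N (x d : 'rV[R]_N) (l : R) :
  inner (x + l *: d) (x + l *: d) = inner x x + 2 * l * inner x d + l ^+ 2 * inner d d.
Proof.
rewrite /inner !mulr_sumr -!big_split /=; apply: eq_bigr => j _.
by rewrite !mxE; ring.
Qed.

Lemma innerBl N (x y d : 'rV[R]_N) : inner (x - y) d = inner x d - inner y d.
Proof.
rewrite /inner -sumrB; apply: eq_bigr => j _.
by rewrite !mxE mulrBl.
Qed.

Definition supp_sub N (u : 'rV[R]_N) (P : 'I_N -> Prop) :=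
  forall j, u 0 j != 0 -> P j.

(* X is the realization of a complex in which two representations of the same
   value of f always lie in a common simplex, even after enlarging the carrier
   of one of them to any simplex containing it. *)
Definition fibre_joinable N M (X : set 'rV[R]_N) (f : 'rV[R]_N -> 'rV[R]_M) :=
  forall s' s t u, X s' -> simplex s -> supp_sub s (fun j => s' 0 j != 0) ->
    X t -> f s = f t -> simplex u ->
    supp_sub u (fun j => s' 0 j != 0 \/ t 0 j != 0) -> X u.

Section Section_of_linear_map.
Context (N M : nat) (X : set 'rV[R]_N) (f : {linear 'rV[R]_N -> 'rV[R]_M}).
Context (Xs : X `<=` @simplex N) (joinX : fibre_joinable X f).

Lemma fibre_segment s t (l : R) : X s -> X t -> f s = f t -> 0 <= l <= 1 ->
  X ((1 - l) *: s + l *: t).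
Proof.
move=> Xx Xt st /andP[l0 l1]; have [s0 s1] := Xs Xx; have [t0 t1] := Xs Xt.
apply: (joinX Xx (Xs Xx) _ Xt st) => //.
  split=> [j|].
    by rewrite !mxE addr_ge0// mulr_ge0// ?subr_ge0.
  under eq_bigr do rewrite !mxE.
  by rewrite big_split /= -!mulr_sumr s1 t1 !mulr1 subrK.
move=> j; rewrite !mxE; apply: contraPP => /not_orP[/negP/negPn/eqP-> /negP/negPn/eqP->].
by rewrite !mulr0 addr0 eqxx.
Qed.

Lemma near_supp (s : 'rV[R]_N) : simplex s ->
  nbhs s [set z : 'rV[R]_N | forall j, s 0 j != 0 -> s 0 j / 2 < z 0 j].
Proof.
move=> [s0 _]; apply: nbhs_forall => j.
have [->|sj] := eqVneq (s 0 j) 0; first exact: filterE.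
have sj0 : 0 < s 0 j by rewrite lt_def sj s0.
have s2 : s 0 j / 2 < s 0 j by lra.
have cj : (fun z : 'rV[R]_N => z 0 j) @ s --> s 0 j by exact: coord_continuous.
by apply: filterS (cvgr_gt _ cj _ s2) => z zj _; exact: zj.
Qed.

(** Points of [X] near a limit [s] have a support containing that of [s], so [s] lies in a face of
    one of their simplices. *)
Lemma fibre_joinable_closed : closed X.
Proof.
move=> s clXs.
have Ss : simplex s.
  by apply: (@simplex_closed N); exact: closureS clXs.
have [z [Xz zs]] := clXs _ (near_supp Ss).
have sz : supp_sub s (fun j => z 0 j != 0).
  move=> j sj; rewrite gt_eqF//; apply: le_lt_trans (zs j sj).
  by rewrite divr_ge0//; case: Ss.
by apply: (joinX Xz (Xs Xz) _ Xz) => // j /sz; left.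
Qed.

Definition least (x : 'rV[R]_M) (t : 'rV[R]_N) :=
  [/\ X t, f t = x & forall u, X u -> f u = x -> inner t t <= inner u u].

Lemma exists_least s : X s -> exists t, least (f s) t.
Proof.
move=> Xx; pose K := X `&` [set u | f u = f s].
have clK : closed K.
  apply: closedI; first exact: fibre_joinable_closed.
  have -> : [set u | f u = f s] = [set u | forall j, f u 0 j = f s 0 j].
    by apply/seteqP; split=> u /= E; [move=> j; rewrite E|exact/rowP].
  apply: closed_forall => j; apply: closed_fun_eq => u.
  exact: (cvg_comp _ _ (@linear_rV_continuous N _ f u) (@coord_continuous R 1 M 0 j (f u))).
have cK : compact K.
  by apply: subclosed_compact clK (@simplex_compact N) _ => u [/Xs].
have [] := @compact_EVT_min _ R (fun u : 'rV[R]_N => inner u u) K _ cK.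
- by exists s.
- by apply: continuous_subspaceT; exact: innerxx_continuous.
move=> t /set_mem[Xt ft] tmin; exists t; split=> // u Xu fu.
by apply: tmin; rewrite inE.
Qed.

(* The chord from s towards t transports to nearby points z, because the
   coordinates of z stay above half those of s. *)
Lemma least_cluster s t : X s -> least (f s) t ->
  (forall B, nbhs s B -> exists z y, B z /\ least y z) -> s = t.
Proof.
move=> Xx [Xt ft tmin] near_s; have Ss := Xs Xx; have St := Xs Xt.
pose e : 'rV[R]_N := t - s.
have te : inner t e <= inner e e / 4.
  (* The midpoint of [s] and [t] stays in the fibre, and [t] has least norm there; expanding the
     square gives the bound. Minimality of nearby [z] against [z + (1 / 2) *: e] gives the next
     one. *)
  have half : 0 <= (1 / 2 : R) <= 1 by lra.
  have Xm := fibre_segment Xt Xx ft half.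
  have tm : (1 - 1 / 2) *: t + (1 / 2) *: s = t + (- (1 / 2)) *: e.
    by apply/rowP => j; rewrite !mxE; field.
  have fm : f (t + (- (1 / 2)) *: e) = f s.
    by rewrite linearD linearZ /= /e linearB ft subrr scaler0 addr0.
  rewrite tm in Xm; have := tmin _ Xm fm; rewrite inner_addZ => h.
  by lra.
have se : - (inner e e / 4) <= inner s e.
  apply/ler_addgt0Pr => eps eps0.
  have cs : (fun z : 'rV[R]_N => inner z e) @ s --> inner s e by exact: inner_continuous.
  have lt_eps : inner s e < inner s e + eps by lra.
  have [z [y [[zs ze] [Xz fz zmin]]]] :=
    near_s _ (filterI (near_supp Ss) (cvgr_lt _ cs _ lt_eps)).
  have z0 := (Xs Xz).1.
  have sz : supp_sub s (fun j => z 0 j != 0).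
    move=> j sj; rewrite gt_eqF//; apply: le_lt_trans (zs j sj).
    by rewrite divr_ge0//; case: Ss.
  have Xu : X (z + (1 / 2) *: e).
    apply: (joinX Xz Ss sz Xt (esym ft)).
      split=> [j|].
        rewrite !mxE; have := St.1 j; have := z0 j.
        by have [->|/zs] := eqVneq (s 0 j) 0; lra.
      under eq_bigr do rewrite !mxE mulrBr.
      by rewrite big_split /= sumrB -!mulr_sumr Ss.2 St.2 (Xs Xz).2 subrr addr0.
    move=> j; rewrite !mxE; apply: contraPP => /not_orP[zj tj].
    have /eqP sj : s 0 j == 0 by apply: contra_notT zj; exact: sz.
    move: zj tj => /negP/negPn/eqP-> /negP/negPn/eqP->.
    by rewrite sj subr0 mulr0 addr0 eqxx.
  have fu : f (z + (1 / 2) *: e) = y.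
    by rewrite linearD linearZ /= /e linearB ft subrr scaler0 addr0.
  have := zmin _ Xu fu; rewrite inner_addZ => h.
  have : 0 <= inner z e + inner e e / 4 by lra.
  by move: ze => /= ze; lra.
(* Subtracting the two bounds shows that [inner e e] is at most half of itself. *)
apply/esym/eqP; rewrite -subr_eq0; apply/eqP/innerxx_eq0.
have := innerBl t s e; rewrite -/e => ee.
lra.
Qed.

(** Continuity follows from compactness: values of [g] near [x] stay in the simplex, and
    [least_cluster] leaves [g x] as their only possible cluster point. *)
Lemma least_section : exists g : 'rV[R]_M -> 'rV[R]_N,
  {within f @` X, continuous g} /\ forall x, (f @` X) x -> least x (g x).
Proof.
have exg x : exists t, (f @` X) x -> least x t.
  have [[s Xx <-]|nx] := pselect ((f @` X) x); last by exists 0.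
  by have [t tP] := exists_least Xx; exists t.
pose g x := sval (cid (exg x)).
have gP x : (f @` X) x -> least x (g x) by exact: (svalP (cid (exg x))).
exists g; split=> //; apply/subspace_continuousP => x Yx.
have PF : ProperFilter (g @ within (f @` X) (nbhs x)).
  by apply: fmap_proper_filter; apply: within_nbhs_proper; exact: subset_closure.
(* A compact neighbourhood of [g x] is called for; the simplex has empty interior, so a cube with
   room around [[0, 1]] is used. *)
have cube := @rV_compact R N (fun=> `[-1, 2]%classic) (fun=> @segment_compact R (-1) 2).
have [Xg fg _] := gP _ Yx.
have FX : (g @ within (f @` X) (nbhs x)) X.
  by apply: (@filterE _ (nbhs x)) => y Yy; have [] := gP _ Yy.
have clus : cluster (g @ within (f @` X) (nbhs x)) `<=` [set g x].
  move=> s cs /=.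
  have Xx : X s.
    by apply: fibre_joinable_closed => B Bs; exact: cs FX Bs.
  have fs : f s = x.
    apply/eqP; rewrite -subr_eq0 -normr_le0; apply/ler_addgt0Pr => e e0.
    rewrite add0r.
    have cf := @linear_rV_continuous N _ f s.
    have e2 : 0 < e / 2 by lra.
    have FA : (g @ within (f @` X) (nbhs x)) [set z | `|x - f z| < e / 2].
      have nx : \forall y \near x, `|x - y| < e / 2.
        by apply: (cvgrPdist_lt (FF := nbhs_filter x) id x).1.
      apply: filterS nx => y xy Yy /=.
      by have [_ -> _] := gP _ Yy.
    have nB := (cvgrPdist_lt (FF := nbhs_filter s) f (f s)).1 cf _ e2.
    have [z [/= xz sz]] := cs _ _ FA nB.
    have -> : f s - x = (f s - f z) - (x - f z) by rewrite opprB addrA subrK.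
    by apply: le_trans (ler_normB _ _) _; move: xz sz => /=; lra.
  apply: least_cluster => //; first by rewrite fs; exact: gP.
  move=> B Bs.
  have FA : (g @ within (f @` X) (nbhs x)) [set z | exists y, least y z].
    by apply: (@filterE _ (nbhs x)) => y Yy; exists y; exact: gP.
  by have [z [[y yz] Bz]] := cs _ _ FA Bs; exists z, y.
apply: (compact_cluster_set1 (@norm_hausdorff _ _) cube).
- apply: nbhs_forall => j; have [g0 _] := Xs Xg; have g1 := simplex_le1 j (Xs Xg).
  have cj : (fun z : 'rV[R]_N => z 0 j) @ g x --> g x 0 j by exact: coord_continuous.
  have lb : -1 < g x 0 j by have := g0 j; lra.
  have ub : g x 0 j < 2 by lra.
  apply: filterS2 (cvgr_gt _ cj _ lb) (cvgr_lt _ cj _ ub) => z /= z1 z2.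
  by rewrite in_itv /= !ltW.
- apply: filterS FX => z Xz j /=; rewrite in_itv /=.
  by have := simplex_le1 j (Xs Xz); have := (Xs Xz).1 j; lra.
- apply/seteqP; split=> // _ ->.
  have [s [_ cs]] := (@simplex_compact N) _ PF (filterS Xs FX).
  by have sg : s = g x := clus _ cs; rewrite sg in cs.
Qed.

Lemma fibre_joinable_hequiv : hequiv R X (f @` X) f.
Proof.
have [g [cg gP]] := least_section.
have cf := @linear_rV_continuous N _ f.
split=> //; first exact: continuous_subspaceT.
have Yf x : X x -> (f @` X) (f x) by move=> Xx; exists x.
exists g; split=> //.
- by move=> _ [x /gP[Xg _ _] <-].
- exists (fun p => (1 - p.1) *: g (f p.2) + p.1 *: p.2); split.
  + apply/subspace_continuousP => -[l x] [/= l01 Xx].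
    set D := [set p : R * 'rV[R]_N | _].
    have c1 : (fun p : R * 'rV[R]_N => p.1) @ within D (nbhs (l, x)) --> l.
      by apply: cvg_within_filter; exact: cvg_fst.
    have c2 : (fun p : R * 'rV[R]_N => p.2) @ within D (nbhs (l, x)) --> x.
      by apply: cvg_within_filter; exact: cvg_snd.
    (* Since [g] is continuous only relative to the image of [X], the limit of [f] must be taken
       within that image. *)
    have c3 : (fun p : R * 'rV[R]_N => f p.2) @ within D (nbhs (l, x))
        --> within (f @` X) (nbhs (f x)).
      move=> U UfX.
      have UfD : nbhs (l, x) (fun p => D p -> (f @` X) (f p.2) -> U (f p.2)).
        exact: (cvg_comp _ _ c2 (cf x) _ UfX).
      apply: (@filterS _ (nbhs (l, x)) _ _ _ _ UfD) => p pU Dp.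
      by apply: (pU Dp); apply: Yf; exact: Dp.2.
    have c4 : (fun p : R * 'rV[R]_N => g (f p.2)) @ within D (nbhs (l, x)) --> g (f x).
      apply: cvg_trans (cvg_comp _ _ c3 ((subspace_continuousP _ _).1 cg _ (Yf _ Xx))) _; exact: cvg_refl.
    have FD : Filter (within D (nbhs (l, x))) by exact: within_filter.
    have c5 : (fun p : R * 'rV[R]_N => 1 - p.1) @ within D (nbhs (l, x)) --> 1 - l.
      by apply: cvgB c1; exact: cvg_cst.
    exact: cvgD (cvgZ c5 c4) (cvgZ c1 c2).
  + move=> [l x] /= l01 Xx; have [Xg fg _] := gP _ (Yf _ Xx).
    exact: fibre_segment.
  + move=> x Xx /=; split; first by rewrite subr0 scale1r scale0r addr0.
    by rewrite subrr scale0r add0r scale1r.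
(* On the image [f] undoes [g], so the constant homotopy serves. *)
- exists (fun p => p.2); split=> //.
    by apply: continuous_subspaceT => p; exact: cvg_snd.
  by move=> y Yy; have [_ -> _] := gP _ Yy.
Qed.

End Section_of_linear_map.
End Topology.

(** * Slices of rhomboids and the equivalence *)

Section Slices.
Context (R : realType) (d n : nat) (a : 'I_n -> 'rV[R]_d).
Implicit Types (r rho : R) (v : {set 'I_n}) (F sigma tau : {set {set 'I_n}}).
Implicit Types (w : {set 'I_n} -> R).

Definition emb_mx : 'M[R]_(#|{set 'I_n}|, d + 1) := \matrix_j emb a (enum_val j).

Lemma bary_weight (y : 'rV[R]_#|{set 'I_n}|) : bary a (weight y) = mulmxr emb_mx y.
Proof.
rewrite /= mulmx_sum_row; apply/rowP => l; rewrite baryE sum_weight summxE.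
by apply: eq_bigr => j _; rewrite rowK !mxE.
Qed.

Lemma sum_pick v (g : {set 'I_n} -> R) : \sum_z (z == v)%:R * g z = g v.
Proof.
rewrite (bigD1 v)//= eqxx mul1r big1 ?addr0// => z /negPf->.
by rewrite mul0r.
Qed.

(** Mass [delta] moves from each of [u] and [v] to [u'] and [v']; written with indicators, it
    remains correct when some of the four coincide. *)
Definition exchange w (delta : R) u v u' v' : {set 'I_n} -> R := fun z =>
  w z + delta * ((z == u')%:R + (z == v')%:R - (z == u)%:R - (z == v)%:R).

Lemma sum_exchange w delta u v u' v' (g : {set 'I_n} -> R) :
  \sum_z exchange w delta u v u' v' z * g z =
  \sum_z w z * g z + delta * (g u' + g v' - g u - g v).
Proof.
rewrite -(sum_pick u') -(sum_pick v') -(sum_pick u) -(sum_pick v).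
rewrite -big_split -!sumrB mulr_sumr -big_split /=.
by apply: eq_bigr => z _; rewrite /exchange; ring.
Qed.

(** Belonging to one vertex and not to another puts the site [i] on the sphere, where it may be
    added or removed freely. *)
Lemma comb_rhomb_exchange c rho (u v : {set 'I_n}) i :
  u \in comb_rhomb a c rho -> v \in comb_rhomb a c rho -> i \in u -> i \notin v ->
  (u :\ i \in comb_rhomb a c rho) /\ (i |: v \in comb_rhomb a c rho).
Proof.
move=> /comb_rhombP[uin uout] /comb_rhombP[vin vout] iu iv.
split; apply/comb_rhombP; split=> j; rewrite !inE.
- by move=> /andP[_]; exact: uin.
- by rewrite negb_and negbK => /orP[/eqP->|]; [exact: vout|exact: uout].
- by move=> /orP[/eqP->|]; [exact: uin|exact: vin].
- by rewrite negb_or => /andP[_]; exact: vout.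
Qed.

Lemma emb_exchange (u v : {set 'I_n}) i (l : 'I_(d + 1)) : i \in u -> i \notin v ->
  emb a (u :\ i) 0 l + emb a (i |: v) 0 l = emb a u 0 l + emb a v 0 l.
Proof.
move=> iu iv; rewrite !mxE; case: (fintype.split l) => m; rewrite ?mxE ?summxE.
  by rewrite (big_setU1 _ iv)/= (big_setD1 i iu)/=; ring.
by rewrite cardsU1 iv [in RHS](cardsD1 i u) iu !natrD /=; ring.
Qed.

(* Slices of a rhomboid are spanned by its vertices: a representation of least
   second moment of the depth has no room for exchanging an element between a
   deep and a shallow vertex, so it lives on two consecutive levels. *)
Lemma hull_at_levels F x : is_rhomboid a F -> hull a F x ->
  exists y i, [/\ simplex y, forall v, v \notin F -> weight y v = 0,
    at_levels i (weight y) & bary a (weight y) = x].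
Proof.
move=> [c [rho [rho0 <-]]]; set F' := comb_rhomb a c rho => -[w [w0 [wF [w1 xw]]]].
pose K := @simplex R #|{set 'I_n}| `&` ([set y | forall v, v \notin F' -> weight y v = 0]
  `&` [set y | forall l, bary a (weight y) 0 l = x 0 l]).
have clK : closed K.
  apply: closedI; first exact: simplex_closed.
  apply: closedI.
    apply: closed_forall => v; have [vF|vF] := boolP (v \notin F').
      have -> : [set y : 'rV[R]_#|{set 'I_n}| | true -> weight y v = 0] =
          [set y | weight y v = 0].
        by apply/seteqP; split=> y /=; [exact|].
      by apply: closed_fun_eq; exact: coord_continuous.
    have -> : [set y : 'rV[R]_#|{set 'I_n}| | false -> weight y v = 0] = setT.
      by apply/seteqP.
    exact: closedT.
  apply: closed_forall => l.
  have -> : [set y | bary a (weight y) 0 l = x 0 l] =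
      [set y | mulmxr emb_mx y 0 l = x 0 l].
    by apply/seteqP; split=> y /=; rewrite bary_weight.
  apply: closed_fun_eq => y.
  exact: (cvg_comp _ _ (@linear_rV_continuous R _ _ (mulmxr emb_mx) y)
    (@coord_continuous R 1 _ 0 l (mulmxr emb_mx y))).
have cK : compact K by apply: subclosed_compact clK (@simplex_compact R _) _ => y [].
have rowK w' : (forall v, 0 <= w' v) -> \sum_v w' v = 1 ->
    (forall v, v \notin F' -> w' v = 0) -> bary a w' = x ->
    K (\row_j w' (enum_val j)).
  move=> w'0 w'1 w'F xw'.
  have wE : weight (\row_j w' (enum_val j)) = w'.
    by apply/funext => v; rewrite weight_row.
  split; last by split=> /= [v|l]; rewrite wE ?xw'//; exact: w'F.
  by split; [apply/weight_ge0|rewrite -sum_weight1]; rewrite wE.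
pose cost (y : 'rV[R]_#|{set 'I_n}|) := \sum_v weight y v * (#|v| ^ 2)%:R.
have ccost : continuous cost.
  apply: (@sum_continuous R _ R^o) => v y.
  by apply: (@cvgMr_tmp _ _ (nbhs y)); exact: coord_continuous.
have [||y /set_mem[Sy [yF xy]] ymin] := @compact_EVT_min _ R cost K _ cK.
- by exists (\row_j w (enum_val j)); exact: rowK.
- exact: continuous_subspaceT.
have y0 := (weight_ge0 y).1 Sy.1.
have y1 : \sum_v weight y v = 1 by rewrite sum_weight1 Sy.2.
have supF v : weight y v != 0 -> v \in F'.
  by apply: contraR => /yF ->.
have close u v : weight y u != 0 -> weight y v != 0 -> (#|u| <= #|v|.+1)%N.
  move=> yu yv; rewrite leqNgt; apply/negP => uv.
  have [i iu iv] : exists2 i, i \in u & i \notin v.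
    apply/subsetPn/negP => /subset_leq_card uv'.
    by have := leq_trans uv uv'; rewrite ltnNge leqnSn.
  have [u'F v'F] := comb_rhomb_exchange (supF _ yu) (supF _ yv) iu iv.
  pose delta := Num.min (weight y u) (weight y v).
  have delta0 : 0 < delta by rewrite lt_min !lt_def yu yv !y0.
  have uNv : (u == v) = false by apply: contraTF uv => /eqP->; rewrite -leqNgt leqW.
  pose w' := exchange (weight y) delta u v (u :\ i) (i |: v).
  have w'0 z : 0 <= w' z.
    have du : delta <= weight y u by rewrite ge_min lexx.
    have dv : delta <= weight y v by rewrite ge_min lexx orbT.
    rewrite /w' /exchange; have := y0 z.
    have p1 : 0 <= delta * (z == u :\ i)%:R by rewrite mulr_ge0// ltW.
    have p2 : 0 <= delta * (z == i |: v)%:R by rewrite mulr_ge0// ltW.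
    have [zu|zu] := eqVneq z u; first by rewrite zu uNv /= in p1 p2 *; lra.
    by have [zv|zv] := eqVneq z v; [rewrite zv in p1 p2 *|]; rewrite /=; lra.
  have w'1 : \sum_z w' z = 1.
    have := sum_exchange (weight y) delta u v (u :\ i) (i |: v) (fun=> 1).
    under eq_bigr do rewrite mulr1; under [in RHS]eq_bigr do rewrite mulr1.
    by move=> ->; rewrite y1; ring.
  have w'F z : z \notin F' -> w' z = 0.
    move=> zF; have zN t : t \in F' -> (z == t) = false.
      by move=> tF; apply: contraNF zF => /eqP->.
    rewrite /w' /exchange yF// !zN//; first by ring.
    exact: supF.
    exact: supF.
  have xw' : bary a w' = x.
    apply/rowP => l; rewrite baryE sum_exchange -baryE xy emb_exchange//.
    by ring.
  (* The exchange changes the cost by [2 * delta] times [#|v| - #|u :\ i|], which is negative,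
     contradicting minimality. *)
  have := ymin _ (mem_set (rowK _ w'0 w'1 w'F xw')).
  rewrite /cost; under [leRHS]eq_bigr do rewrite weight_row.
  rewrite sum_exchange cardsU1 iv [in leRHS](cardsD1 i u) iu /=.
  move: uv; rewrite (cardsD1 i u) iu /= add1n ltnS => uv.
  have : (#|v|%:R < #|u :\ i|%:R :> R) by rewrite ltr_nat.
  rewrite !natrX !natrD => lt_vu.
  by have := mulr_gt0 delta0 (_ : 0 < #|u :\ i|%:R - #|v|%:R); rewrite subr_gt0 => /(_ lt_vu); nra.
have [v0 yv0] : exists v0, weight y v0 != 0.
  apply: contrapT => /forallNP y00; move: y1; rewrite big1 => [/esym/eqP|v _].
    by rewrite oner_eq0.
  by apply/eqP/negPn/negP; exact: y00.
case: (@arg_minnP _ v0 (fun v => weight y v != 0) (fun v => #|v|) yv0) => v1 yv1 v1min.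
exists y, #|v1|; split=> //; last by apply/rowP => l; exact: xy.
move=> v yv; have := v1min _ yv; have := close _ _ yv yv1.
by rewrite leq_eqVlt => /orP[/eqP->|]; [right|left; apply/eqP; rewrite eqn_leq; apply/andP].
Qed.

Lemma edist_continuous (p : 'rV[R]_d) : continuous (fun b : 'rV[R]_d => edist b p).
Proof.
have csum : continuous (fun b : 'rV[R]_d => \sum_j (b 0 j - p 0 j) ^+ 2).
  apply: (@sum_continuous R _ R^o) => j z.
  have cj : (fun z : 'rV[R]_d => z 0 j - p 0 j) @ z --> z 0 j - p 0 j.
    by apply: (@cvgB _ _ _ (nbhs z)); [exact: coord_continuous|exact: cvg_cst].
  exact: (cvg_comp _ _ cj (@exprn_continuous R 2 _)).
move=> b; exact: (cvg_comp _ _ (csum b) (@sqrt_continuous R _)).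
Qed.

Lemma coord_le_edist (b p : 'rV[R]_d) j : `|b 0 j - p 0 j| <= edist b p.
Proof.
rewrite -sqrtr_sqr ler_wsqrtr// (bigD1 j)//= lerDl.
by apply: sumr_ge0 => i _; exact: sqr_ge0.
Qed.

(* The infimum defining the radius of a rhomboid is attained by a limit of
   centres, for which only the closed conditions survive. *)
Lemma rhomb_radius_attained F r v0 : is_rhomboid a F -> rhomb_radius a F <= r ->
  v0 \in F -> v0 != finset.set0 ->
  exists b, forall v, v \in F -> Ball a r v b /\ Vor a v b.
Proof.
move=> [c0 [rho0 [rho00 F0]]] Fr v0F /set0Pn[i0 i0v0].
pose T s : set 'rV[R]_d := [set b | forall v, v \in F -> Ball a s v b /\ Vor a v b].
have clT s : closed (T s).
  have -> : T s = [set b | forall q : {set 'I_n} * 'I_n * 'I_n,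
      (q.1.1 \in F -> q.1.2 \in q.1.1 -> edist b (a q.1.2) <= s) /\
      (q.1.1 \in F -> q.1.2 \in q.1.1 -> q.2 \notin q.1.1 ->
        edist b (a q.1.2) - edist b (a q.2) <= 0)].
    apply/seteqP; split=> b /= Tb.
      move=> [[v i] j] /=; split=> vF; have [Bv Vv] := Tb v vF; first exact: Bv.
      by move=> iv jv; rewrite subr_le0; exact: Vv.
    move=> v vF; split=> [i iv|i j iv jv]; first exact: (Tb (v, i, i)).1.
    by rewrite -subr_le0; exact: (Tb (v, i, j)).2.
  have closed_imp (Q : Prop) (P : set 'rV[R]_d) : closed P -> closed [set b | Q -> P b].
    move=> cP; have [q|nq] := pselect Q.
      suff -> : [set b | Q -> P b] = P by [].
      by apply/seteqP; split=> b //=; exact.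
    have -> : [set b | Q -> P b] = setT by apply/seteqP; split=> b //= _ /nq.
    exact: closedT.
  apply: closed_forall => -[[v i] j] /=; apply: closedI.
    do 2 apply: (closed_imp); apply: closed_fun_le; exact: edist_continuous.
  do 3 apply: (closed_imp); apply: closed_fun_le => b.
  by apply: (@cvgB _ _ _ (nbhs b)); exact: edist_continuous.
have T_ex (m : nat) : exists b, T (r + m.+1%:R^-1) b.
  have e0 : 0 < m.+1%:R^-1 :> R by rewrite invr_gt0.
  have [||rho [b [rho_gt0 FE]] rho_lt] := @inf_lt _ [set rho | exists c,
      0 < rho /\ comb_rhomb a c rho = F] (r + m.+1%:R^-1).
  - by exists rho0, c0.
  - by apply: le_lt_trans Fr _; rewrite ltrDl.
  by exists b => v; rewrite -FE => vF; apply: comb_rhomb_Ball vF (ltW rho_lt).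
pose b_ m := sval (cid (T_ex m)).
have Tb m : T (r + m.+1%:R^-1) (b_ m) by exact: (svalP (cid (T_ex m))).
have T_le s s' : s <= s' -> T s `<=` T s'.
  move=> ss b Tsb v vF; have [Bv Vv] := Tsb v vF; split=> // i iv.
  exact: le_trans (Bv i iv) ss.
(* The vertex [v0] is nonempty, and its site [i0] is within [r + 1] of every such centre, which
   bounds them. *)
have cT : compact (T (r + 1)).
  apply: bounded_closed_compact; last exact: clT.
  exists (`|a i0| + (r + 1)); split; first exact: num_real.
  move=> M rM b Tb1 /=; apply: ltW; apply: le_lt_trans rM.
  have -> : b = a i0 + (b - a i0) by rewrite addrC subrK.
  apply: le_trans (ler_normD _ _) _; rewrite lerD2l.
  have r1 : edist b (a i0) <= r + 1 by have [Bv _] := Tb1 _ v0F; exact: Bv.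
  rewrite [leLHS]mx_normrE; apply: bigmax_le => [|[k l] _ /=].
    exact: le_trans (edist_ge0 _ _) r1.
  by rewrite ord1 !mxE; apply: le_trans (coord_le_edist _ _ _) r1.
have Tnear m : (b_ @ \oo) (T (r + m.+1%:R^-1)).
  exists m => // l /= ml; apply: T_le (Tb l); rewrite lerD2l lef_pV2 ?posrE//.
  by rewrite ler_nat.
have [b [Tb1 cb]] : T (r + 1) `&` cluster (b_ @ \oo) !=set0.
  by apply: cT; have := Tnear 0%N; rewrite invr1.
(* The sets [T] are closed and each contains a tail of the sequence, so the cluster point lies in
   all of them. *)
have Tbm m : T (r + m.+1%:R^-1) b by apply: clT => B Bb; exact: cb (Tnear m) Bb.
exists b => v vF; split; last by have [] := Tbm 0%N v vF.
move=> i iv; apply/ler_addgt0Pr => e e0.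
have [m _ me] := near_infty_natSinv_lt (PosNum e0).
have [Bv _] := Tbm m v vF; apply: le_trans (Bv i iv) _; rewrite lerD2l ltW//.
exact: (me m (leqnn m)).
Qed.

(** Represent the point on two consecutive levels of [F], raised to at least [k] by the depth bound.
    A centre attaining the radius of [F] is a common point for all its vertices, so the support is a
    simplex. *)
Lemma SRhomb_SDel r k : (0 < k)%N ->
  SRhomb a r k `<=` mulmxr emb_mx @` SDel a r k.
Proof.
move=> k0 x [C [_ Cx [F [rF CF _ Fr]] Ck]].
have [y [i [Sy yF yi xy]]] := hull_at_levels rF (CF x Cx).
have y0 := (weight_ge0 y).1 Sy.1.
have y1 : \sum_v weight y v = 1 by rewrite sum_weight1 Sy.2.
have kd : k%:R <= depth (bary a (weight y)) by rewrite xy; exact: Ck.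
have [j kj yj] := at_levels_raise y0 y1 kd yi.
have [v0 yv0] : exists v0, weight y v0 != 0.
  apply: contrapT => /forallNP y00; move: y1; rewrite big1 => [/esym/eqP|v _].
    by rewrite oner_eq0.
  by apply/eqP/negPn/negP; exact: y00.
have supF v : weight y v != 0 -> v \in F by apply: contraR => /yF ->.
have v0N0 : v0 != finset.set0.
  rewrite -card_gt0; apply: leq_trans (at_levels_ge yj yv0).
  exact: leq_trans kj.
have [b bF] := rhomb_radius_attained rF Fr (supF _ yv0) v0N0.
exists y; last by rewrite -bary_weight.
exists [set v | weight y v != 0]%SET; split; [|exact: Sy.1| |exact: Sy.2].
- exists j; split=> // [v|]; first by rewrite inE; exact: yj.
  by exists b => v; rewrite inE => /supF/bF.
- by move=> v; rewrite inE negbK => /eqP.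
Qed.

Lemma SDel_image r k : injective a -> (0 < k)%N ->
  mulmxr emb_mx @` SDel a r k = SRhomb a r k.
Proof.
move=> inja k0; apply/seteqP; split; last exact: SRhomb_SDel.
by move=> _ [y yD <-]; rewrite -bary_weight; exact: SDel_SRhomb.
Qed.

Lemma SDel_sub_simplex r k : SDel a r k `<=` @simplex R #|{set 'I_n}|.
Proof. by move=> y [sigma [_ y0 _ y1]]. Qed.

Lemma SDel_fibre_joinable r k : (0 < k)%N ->
  fibre_joinable (SDel a r k) (mulmxr emb_mx).
Proof.
move=> k0 s' s t u [sigma [Ks _ s'sig _]] Ss ss' Dt st Su us't.
have ssig v : v \notin sigma -> weight s v = 0.
  move=> /s'sig s'v; apply/eqP/negPn/negP => /ss' /negP; apply.
  by rewrite s'v.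
have [|tau [Kt sub tt]] := SDel_simplexU k0 Ks Ss.1 Ss.2 ssig Dt.
  by rewrite !bary_weight.
exists tau; split=> //; [exact: Su.1| |exact: Su.2].
move=> v vtau; apply/eqP/negPn/negP => /us't[/negP|/tt]; last by apply/negP.
by apply; apply/eqP; apply: s'sig; apply: contra vtau; exact: sub.
Qed.

Lemma SRhomb_is_bifilt : is_bifilt (SRhomb_bifilt a).
Proof.
move=> r r' k k' r0 rr' k'0 k'k x [C [sC Cx [F [rF CF Fmin Fr]] Ck]].
exists C; split=> //; first by exists F; split=> //; exact: le_trans rr'.
by move=> z Cz; apply: le_trans (Ck z Cz); rewrite ler_nat.
Qed.

Lemma SDel_is_bifilt : is_bifilt (SDel_bifilt a).
Proof.
move=> r r' k k' r0 rr' k'0 k'k x [sigma [[i [ki card [b bv]]] x0 xs x1]].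
exists sigma; split=> //; exists i; split=> //; first exact: leq_trans ki.
exists b => v vs; have [Bv Vv] := bv v vs; split=> // l lv.
exact: le_trans (Bv l lv) rr'.
Qed.
End Slices.

Theorem theorem9 (R : realType) (d n : nat) (a : 'I_n -> 'rV[R]_d) :
  (0 < d)%N -> general_position a ->
  weakly_equivalent (SRhomb_bifilt a) (SDel_bifilt a).
Proof.
move=> _ [inja _].
apply: (@weq_bwd R _ (SDel_bifilt a)); [exact: SRhomb_is_bifilt| |
  by apply: weq_refl; exact: SDel_is_bifilt].
(* One linear map serves every [r] and [k], so compatibility with the inclusions is immediate. *)
exists (fun _ _ => mulmxr (emb_mx a)); split=> // r k _ k0 /=.
rewrite -(SDel_image r inja k0); apply: fibre_joinable_hequiv.
  exact: SDel_sub_simplex.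
exact: SDel_fibre_joinable.
Qed.
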